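(* Let $\varepsilon,\delta\in(0,1)$, let $P_{s1}>0$ and $P_{s2}=0$. Suppose that $N$ is the minimum positive integer such that $$F_{\chi^2,2N}\big((1+\varepsilon)2N\big)-F_{\chi^2,2N}\big((1-\varepsilon)2N\big)\ge\sqrt{1-\delta}.$$ Then, in the two-power noisy Rayleigh measurement model described in the context, $$\Pr\left\{\frac{1}{P_{s1}}\left(\frac{(1-\varepsilon)\overline{X_{1,N}^2}}{(1+\varepsilon)\overline{X_{2,N}^2}}-1\right)<\frac{\sigma_H^2}{\sigma_V^2}<\frac{1}{P_{s1}}\left(\frac{(1+\varepsilon)\overline{X_{1,N}^2}}{(1-\varepsilon)\overline{X_{2,N}^2}}-1\right)\right\}>1-\delta .$$
   Context: $F_{\chi^2,2N}$ denotes the cumulative distribution function of a $\chi^2$ random variable with $2N$ degrees of freedom. Two-power noisy Rayleigh measurement model: let $\sigma_H^2,\sigma_V^2>0$ and $P_{s1}>P_{s2}\ge0$. For $\ell=1,2$ and $i=1,\dots,N$, real (BPSK) symbols $S_{\ell,i}$ with $|S_{\ell,i}|^2=P_{s\ell}$ are transmitted, and one observes the complex random variables $X_{\ell,i}=H_{\ell,i}S_{\ell,i}+V_{\ell,i}$, where the real and imaginary parts of $H_{\ell,i}$ are Gaussian with mean $0$ and variance $\sigma_H^2$, the real and imaginary parts of $V_{\ell,i}$ are Gaussian with mean $0$ and variance $\sigma_V^2$, and all these real and imaginary parts (over all $\ell,i$) are mutually independent. Thus the $X_{\ell,i}$ are mutually independent, and the real and imaginary parts of $X_{\ell,i}$ are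 independent centered Gaussians of variance $P_{s\ell}\sigma_H^2+\sigma_V^2$. Define $$\overline{X_{\ell,N}^2}=\frac{1}{2N}\sum_{i=1}^{N}|X_{\ell,i}|^2,\qquad \ell=1,2.$$ *)

(* Defs.v *)
From HB Require Import structures.
From mathcomp Require Import all_boot all_order all_algebra complex.
From mathcomp Require Import all_classical all_reals all_analysis.
From mathcomp Require Import measurable_realfun lebesgue_measure.

Set Implicit Arguments.
Unset Strict Implicit.
Unset Printing Implicit Defensive.
Import Order.TTheory GRing.Theory Num.Theory.
Import numFieldNormedType.Exports.

Local Open Scope classical_set_scope.
Local Open Scope ring_scope.

Definition has_law (d : measure_display) (T : measurableType d) (R : realType)
    (P : probability T R) (X : T -> R)
    (mu : probability (measurableTypeR R) R) : Prop :=
  measurable_fun setT X /\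
  forall A : set R, measurable A -> P (X @^-1` A) = mu A.

Definition mutually_independent (d : measure_display) (T : measurableType d)
    (R : realType) (P : probability T R) (I : finType) (X : I -> T -> R)
    : Prop :=
  forall (J : {set I}) (A : I -> set R), (forall i, measurable (A i)) ->
    P [set t | forall i, i \in J -> A i (X i t)] =
    (\prod_(i in J) P (X i @^-1` A i))%E.

Definition add_sqr (R : realType) (p : measurableTypeR R * measurableTypeR R)
    : measurableTypeR R :=
  p.1 + p.2 ^+ 2.

Lemma measurable_add_sqr (R : realType) : measurable_fun setT (@add_sqr R).
Proof.
apply: measurable_funD; first exact: measurable_fst.
by apply: measurable_funX; exact: measurable_snd.
Qed.

HB.instance Definition _ (R : realType) :=
  isMeasurableFun.Build _ _ _ _ (@add_sqr R) (@measurable_add_sqr R).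

(* The law of Z_1^2 + ... + Z_k^2 for independent standard normal Z_1, ..., Z_k,
   where Z_k is adjoined as the second coordinate of a product space. *)
Fixpoint chi2 (R : realType) (k : nat) : probability (measurableTypeR R) R :=
  if k is k'.+1 then
    distribution (chi2 R k' \x normal_prob (0 : R) 1)%E (@add_sqr R)
  else @dirac _ (measurableTypeR R) (0 : R) R.

Definition chi2_cdf (R : realType) (k : nat) (x : R) : R :=
  fine (chi2 R k `]-oo, x]%classic).

(* The index (l, i, b, c) selects the noise H_{l,i} if b and V_{l,i} otherwise,
   and its real part if c and its imaginary part otherwise. *)
Definition noise_part (T : Type) (R : realType) (N : nat)
    (H V : 'I_2 -> 'I_N -> T -> complex R)
    (k : 'I_2 * 'I_N * bool * bool) : T -> R :=
  let: (l, i, b, c) := k in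
  fun t => (if c then @complex.Re R else @complex.Im R)
             ((if b then H else V) l i t).

(* The powers P_{s1} and P_{s2} are [Ps ord0] and [Ps ord_max]. The symbols are
   deterministic. [sigmaH] and [sigmaV] are standard deviations, which is also
   the convention of [normal_prob]. *)
Record rayleigh_model (d : measure_display) (T : measurableType d)
    (R : realType) (P : probability T R) (N : nat) (sigmaH sigmaV : R)
    (Ps : 'I_2 -> R) (S : 'I_2 -> 'I_N -> R)
    (H V X : 'I_2 -> 'I_N -> T -> complex R) : Prop := RayleighModel {
  rm_sigmaH_gt0 : 0 < sigmaH;
  rm_sigmaV_gt0 : 0 < sigmaV;
  rm_power_ge0 : 0 <= Ps ord_max;
  rm_power_lt : Ps ord_max < Ps ord0;
  rm_symbol : forall l i, `|S l i| ^+ 2 = Ps l;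
  rm_H_Re : forall l i,
    has_law P (fun t => complex.Re (H l i t)) (normal_prob 0 sigmaH);
  rm_H_Im : forall l i,
    has_law P (fun t => complex.Im (H l i t)) (normal_prob 0 sigmaH);
  rm_V_Re : forall l i,
    has_law P (fun t => complex.Re (V l i t)) (normal_prob 0 sigmaV);
  rm_V_Im : forall l i,
    has_law P (fun t => complex.Im (V l i t)) (normal_prob 0 sigmaV);
  rm_independent : mutually_independent P (noise_part H V);
  rm_observation : forall l i t,
    X l i t = H l i t * real_complex R (S l i) + V l i t
}.

Definition mean_sqr (T : Type) (R : realType) (N : nat)
    (X : 'I_2 -> 'I_N -> T -> complex R) (l : 'I_2) (t : T) : R :=
  (2 * N)%:R^-1 * \sum_(i < N) ComplexField.Normc.normc (X l i t) ^+ 2.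

Definition chi2_condition (R : realType) (eps delta : R) (N : nat) : Prop :=
  chi2_cdf (2 * N) ((1 + eps) * (2 * N)%:R)
    - chi2_cdf (2 * N) ((1 - eps) * (2 * N)%:R) >= Num.sqrt (1 - delta).

(* Main.v *)
From HB Require Import structures.
Require Import Defs.
From mathcomp Require Import all_boot all_order all_algebra complex.
From mathcomp Require Import all_classical all_reals all_analysis.
From mathcomp Require Import measurable_realfun lebesgue_measure ring lra.

(* With n = 2N and tau_l^2 = P_{sl} sigma_H^2 + sigma_V^2, the statistics
   Q_l = n X_l^2 / tau_l^2, where X_l^2 is the mean square of the observations,
   are independent and chi^2 with n degrees of freedom. The event to be bounded
   says exactly that the ratio Q_1 / Q_2 lies strictly between
   (1 - eps)/(1 + eps) and its inverse. It contains the event that both Q_l lie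
   in ](1 - eps) n, (1 + eps) n], of probability at least sqrt(1 - delta)^2.
   The strict inequality comes from a second, disjoint part of the event: both
   Q_l may also lie in an interval just above (1 + eps) n, which has positive
   probability. *)

Set Implicit Arguments.
Unset Strict Implicit.
Unset Printing Implicit Defensive.
Import Order.TTheory GRing.Theory Num.Theory.
Import numFieldNormedType.Exports.

Local Open Scope classical_set_scope.
Local Open Scope ring_scope.

(** The canonical instance is applied by name because measurability of [f] is a hypothesis here
    rather than a structure on [f]. *)
Definition image_measure d d' (T1 : measurableType d) (T2 : measurableType d')
    (R : realType) (m : {measure set T1 -> \bar R}) (f : T1 -> T2)
    (mf : measurable_fun setT f) : {measure set T2 -> \bar R} :=
  measure_function_pushforward__canonical__measure_function_Measure m mf.

(** * Normal laws under affine maps and convolution *)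

Section normal_affine.
Context (R : realType).
Local Notation mu := (@lebesgue_measure R).

Definition affine (a b : R) (x : measurableTypeR R) : measurableTypeR R :=
  a * x + b.

Lemma measurable_affine (a b : R) : measurable_fun setT (affine a b).
Proof. by apply: measurable_funD => //; exact: measurable_funM. Qed.

(** The right-hand side is a measure in [A] that gives half-open intervals their length, so
    uniqueness of Lebesgue measure applies. *)
Lemma lebesgue_measure_affine (a b : R) (a0 : 0 < a) (A : set R) :
  measurable A ->
  mu A = (a%:E * mu (affine a b @^-1` A))%E.
Proof.
move=> mA.
pose nu := mscale (NngNum (ltW a0)) (image_measure mu (measurable_affine a b)).
have -> : (a%:E * mu (affine a b @^-1` A))%E = nu A by [].
apply: lebesgue_measure_unique => // _ [[c d] /= _ <-].
rewrite /nu /mscale /= /pushforward.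
have -> : affine a b @^-1` `]c, d] = `](c - b) / a, (d - b) / a]%classic.
  apply/seteqP; split => x /=; rewrite !in_itv /= /affine;
    by rewrite ltr_pdivrMr // ler_pdivlMr // ltrBlDr lerBrDr [x * a]mulrC.
rewrite !lebesgue_measure_itv /= !lte_fin.
rewrite ltr_pM2r ?invr_gt0 // ltrD2r.
case: ifP => _; last by rewrite mule0.
by rewrite -!EFinB -EFinM; congr EFin; field; rewrite gt_eqF.
Qed.

Lemma normal_pdf_affine (m s a b x : R) : 0 < a -> s != 0 ->
  a * normal_pdf (a * m + b) (a * s) (a * x + b) = normal_pdf m s x.
Proof.
move=> a0 s0; have as0 : a * s != 0 by rewrite mulf_neq0 // gt_eqF.
rewrite !normal_pdfE // /normal_peak /normal_fun mulrA; congr (_ * expR _).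
  rewrite exprMn -mulrnAr -mulrA sqrtrM ?sqr_ge0 // sqrtr_sqr gtr0_norm //.
  by rewrite invfM mulrA divff ?gt_eqF // mul1r mulrnAr.
rewrite -(mulr_natr _ 2) -(mulr_natr (s ^+ 2) 2); field.
by rewrite s0 gt_eqF.
Qed.

(** Change of variables: Lebesgue measure becomes [a] times its pushforward, and the Jacobian [a] is
    absorbed by the density through [normal_pdf_affine]. *)
Lemma normal_prob_affine (m s a b : R) (A : set R) : 0 < a -> s != 0 ->
  measurable A ->
  normal_prob m s (affine a b @^-1` A) = normal_prob (a * m + b) (a * s) A.
Proof.
move=> a0 s0 mA.
pose nu := mscale (NngNum (ltW a0)) (image_measure mu (measurable_affine a b)).
rewrite /normal_prob.
rewrite [RHS](eq_measure_integral nu); last first.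
  by move=> B mB _; exact: lebesgue_measure_affine.
rewrite ge0_integral_mscale //; last 2 first.
- apply/measurable_funTS/measurable_EFinP; exact: measurable_normal_pdf.
- by move=> x _; rewrite lee_fin normal_pdf_ge0.
rewrite (ge0_integral_pushforward (measurable_affine a b)) //; last 2 first.
- apply/measurable_funTS/measurable_EFinP; exact: measurable_normal_pdf.
- by move=> x _; rewrite lee_fin normal_pdf_ge0.
rewrite -ge0_integralZl //; last 3 first.
- by rewrite -[X in measurable X]setTI; exact: measurable_affine.
- apply: measurable_funTS; apply: measurableT_comp.
    apply/measurable_EFinP; exact: measurable_normal_pdf.
  exact: measurable_affine.
- by move=> x _; rewrite lee_fin normal_pdf_ge0.
by apply: eq_integral => x _ /=; rewrite -EFinM normal_pdf_affine.
Qed.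

(** The Radon-Nikodym derivative of the normal law equals [normal_pdf] almost everywhere, since both
    have the same integral over every measurable set. Finiteness gives the integrability that the
    change of variables requires. *)
Lemma ge0_integral_normal_prob (m s : R) (f : R -> \bar R) :
  measurable_fun setT f -> (forall x, 0 <= f x)%E ->
  (\int[normal_prob m s]_x f x < +oo)%E ->
  (\int[normal_prob m s]_x f x =
   \int[mu]_x (f x * (normal_pdf m s x)%:E))%E.
Proof.
move=> mf f0 finf.
rewrite -(Radon_Nikodym_change_of_variables (normal_prob_dominates m s))//=;
  last first.
  apply/integrableP; split => //.
  by under eq_integral do rewrite gee0_abs //.
apply: ae_eq_integral => //.
- apply: emeasurable_funM => //; apply: (measurable_int mu).
  by apply: Radon_Nikodym_integrable; exact: normal_prob_dominates.
- apply: emeasurable_funM => //; apply/measurable_EFinP.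
  exact: measurable_normal_pdf.
- apply: ae_eqe_mul2l => /=.
  rewrite Radon_NikodymE//=; first exact: normal_prob_dominates.
  move=> dom; case: cid => /= h [h1 h2 h3].
  apply: integral_ae_eq => //=.
  + by apply/measurable_EFinP; exact: measurable_normal_pdf.
  + by move=> E _ mE; rewrite -h3.
Qed.

Lemma normal_peakE (s : R) : 0 < s ->
  normal_peak s = (s * Num.sqrt (pi *+ 2))^-1.
Proof.
move=> s0; rewrite /normal_peak -mulrnAr sqrtrM ?sqr_ge0 //.
by rewrite sqrtr_sqr gtr0_norm.
Qed.

(* Completing the square in x; the last factor integrates to 1 in x, which
   gives the convolution of two normal laws. *)
Lemma normal_pdf_mul (s1 s2 c x z : R) : 0 < s1 -> 0 < s2 ->
  let t := Num.sqrt (c ^+ 2 * s1 ^+ 2 + s2 ^+ 2) in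
  normal_pdf (c * x) s2 z * normal_pdf 0 s1 x =
  normal_pdf 0 t z * normal_pdf (c * s1 ^+ 2 * z / t ^+ 2) (s1 * s2 / t) x.
Proof.
move=> s10 s20 t.
have t20 : 0 < c ^+ 2 * s1 ^+ 2 + s2 ^+ 2.
  by rewrite ltr_wpDl ?exprn_gt0 // mulr_ge0 ?sqr_ge0.
have t0 : 0 < t by rewrite sqrtr_gt0.
have t2E : t ^+ 2 = c ^+ 2 * s1 ^+ 2 + s2 ^+ 2 by rewrite sqr_sqrtr // ltW.
clearbody t; have r0 : 0 < s1 * s2 / t by rewrite divr_gt0 // mulr_gt0.
rewrite !normal_pdfE ?gt_eqF // !normal_peakE // /normal_fun.
rewrite mulrACA [RHS]mulrACA -!expRD; congr (_ * expR _).
  have : Num.sqrt (pi *+ 2) != 0 :> R.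
    by rewrite gt_eqF // sqrtr_gt0 mulrn_wgt0 // pi_gt0.
  move: (Num.sqrt _) => K K0; field.
  by rewrite K0 !gt_eqF.
rewrite expr_div_n t2E !mulr2n; field.
rewrite -exprMn in t20.
apply/and5P; split; rewrite gt_eqF //;
  first [exact: addr_gt0 | by rewrite ?addr_gt0 ?exprn_gt0 ?mulr_gt0].
Qed.

Definition add_scaled (c : R) (p : measurableTypeR R * measurableTypeR R)
    : measurableTypeR R := c * p.1 + p.2.

Lemma measurable_add_scaled (c : R) : measurable_fun setT (add_scaled c).
Proof.
apply: measurable_funD; last exact: measurable_snd.
by apply: measurable_funM => //; exact: measurable_fst.
Qed.

(** The product measure is a double integral over [x] and the value [z = c * x + y]. Tonelli puts
    [z] outside; [normal_pdf_mul] then isolates the density of [z], and the remaining density in [x]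
    has integral 1. *)
Lemma normal_prob_convolution (s1 s2 c : R) (A : set R) : 0 < s1 -> 0 < s2 ->
  measurable A ->
  (normal_prob 0 s1 \x normal_prob 0 s2)%E (add_scaled c @^-1` A) =
  normal_prob 0 (Num.sqrt (c ^+ 2 * s1 ^+ 2 + s2 ^+ 2)) A.
Proof.
move=> s10 s20 mA; set t := Num.sqrt _.
have mS : measurable (add_scaled c @^-1` A).
  by rewrite -[X in measurable X]setTI; exact: measurable_add_scaled.
(* Each section is a translate of [A], so its mass is that of [A] under the normal law with mean
   [c * x]. *)
have secE x : xsection (add_scaled c @^-1` A) x = affine 1 (c * x) @^-1` A.
  by apply/seteqP; split => y /=;
    rewrite /xsection /= inE /= /add_scaled /affine /= mul1r addrC.
have mphi := measurable_fun_xsection (normal_prob 0 s2) mS.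
rewrite /product_measure1 ge0_integral_normal_prob //; last first.
  apply: (@le_lt_trans _ _ (\int[normal_prob 0 s1]_x (cst 1 x)))%E.
    apply: ge0_le_integral => // x _ /=.
    by apply: probability_le1; exact: measurable_xsection.
  by rewrite integral_cst //= mul1e probability_setT ltry.
pose f (p : measurableTypeR R * measurableTypeR R) : \bar R :=
   ((\1_A p.2)%:E * (normal_pdf (c * p.1) s2 p.2 * normal_pdf 0 s1 p.1)%:E)%E.
pose g (p : measurableTypeR R * measurableTypeR R) :=
  normal_pdf (c * p.1) s2 p.2.
have mg : measurable_fun setT g.
  (* Moving the mean into the argument turns joint measurability into that of one fixed density. *)
  have -> : g = normal_pdf 0 s2 \o (fun p => p.2 - c * p.1).
    apply/funext => p; rewrite /g /= !normal_pdfE ?gt_eqF //.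
    by rewrite /normal_fun subr0.
  apply: measurableT_comp; first exact: measurable_normal_pdf.
  apply: measurable_funB; first exact: measurable_snd.
  by apply: measurable_funM => //; exact: measurable_fst.
have mf : measurable_fun setT f.
  apply: emeasurable_funM; apply/measurable_EFinP.
    by apply: measurableT_comp; [exact: measurable_indic|exact: measurable_snd].
  apply: measurable_funM => //.
  apply: measurableT_comp; first exact: measurable_normal_pdf.
  exact: measurable_fst.
have f0 p : (0 <= f p)%E.
  by rewrite mule_ge0 // lee_fin // mulr_ge0 // normal_pdf_ge0.
transitivity (\int[mu]_x \int[mu]_y f (x, y))%E.
  apply: eq_integral => x _.
  rewrite /= secE normal_prob_affine ?gt_eqF // !mul1r add0r.
  rewrite /normal_prob integral_mkcond -ge0_integralZr //=; last 3 first.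
  - apply/measurable_restrict => //; apply/measurable_EFinP.
    exact: measurable_funTS (measurable_normal_pdf _ _).
  - move=> y _; rewrite erestrict_ge0 // => w _.
    by rewrite lee_fin normal_pdf_ge0.
  - by rewrite lee_fin normal_pdf_ge0.
  apply: eq_integral => y _; rewrite /f /= patchE indicE.
  by case: ifPn => _; rewrite ?mul1e ?mul0e.
rewrite (fubini_tonelli f) // [RHS]integral_mkcond.
apply: eq_integral => y _; rewrite patchE.
under eq_integral do rewrite /f /= normal_pdf_mul // -/t.
case: ifPn => yA; last first.
  by rewrite integral0_eq // => x _; rewrite indicE (negbTE yA) mul0e.
under eq_integral do rewrite indicE yA mul1e EFinM.
rewrite ge0_integralZl //=; last 3 first.
- by apply/measurable_EFinP; exact: measurable_normal_pdf.
- by move=> x _; rewrite lee_fin normal_pdf_ge0.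
- by rewrite lee_fin normal_pdf_ge0.
by rewrite integral_normal_pdf mule1.
Qed.

End normal_affine.

Lemma measurable_preimage d d' (T : measurableType d)
    (U : measurableType d') (f : T -> U) (A : set U) :
  measurable_fun setT f -> measurable A -> measurable (f @^-1` A).
Proof. by move=> mf mA; rewrite -[X in measurable X]setTI; exact: mf. Qed.

(** * Joint laws of independent variables and independence of group sums *)

Section independence.
Context d (T : measurableType d) (R : realType) (P : probability T R).

(** When [P C] is nonzero, the law of the pair conditioned on [C] agrees with the product measure on
    rectangles, hence everywhere. When [P C] is zero, both sides vanish. *)
Lemma probability_pair_setI d1 d2 (T1 : measurableType d1)
    (T2 : measurableType d2) (X : T -> T1) (Y : T -> T2)
    (PX : probability T1 R) (PY : probability T2 R) (C : set T) :
  measurable_fun setT X -> measurable_fun setT Y -> measurable C ->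
  (forall A B, measurable A -> measurable B ->
    P (X @^-1` A `&` Y @^-1` B `&` C) = (PX A * PY B * P C)%E) ->
  forall E, measurable E ->
  P ((fun t => (X t, Y t)) @^-1` E `&` C) = ((PX \x PY) E * P C)%E.
Proof.
move=> mX mY mC XYC E mE.
have mXY := measurable_fun_pair mX mY.
have [PC0|PC0] := eqVneq (P C) 0%E.
  rewrite PC0 mule0; apply: (@subset_measure0 _ _ _ P _ C) => //.
    by apply: measurableI => //; exact: measurable_preimage.
have fC : (P C) \is a fin_num by exact: fin_num_measure.
have c0 : 0 < fine (P C).
  by rewrite -lte_fin fineK // lt0e PC0 measure_ge0.
have [k kC] : exists k : {nonneg R}, (k%:num%:E * P C = 1)%E.
  have ic0 : 0 <= (fine (P C))^-1 by rewrite invr_ge0 ltW.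
  exists (NngNum ic0) => /=.
  by rewrite -[in X in (_ * X)%E](fineK fC) -EFinM mulVf ?gt_eqF.
pose nu := mscale k (image_measure (mrestr P mC) mXY).
have nuE F :
  nu F = (k%:num%:E * P ((fun t => (X t, Y t)) @^-1` F `&` C))%E by [].
have -> : (PX \x PY)%E E = nu E.
  apply: product_measure_unique => // A B mA mB.
  transitivity (k%:num%:E * P (X @^-1` A `&` Y @^-1` B `&` C))%E; first by [].
  by rewrite XYC // muleCA kC mule1.
by rewrite nuE muleAC kC mul1e.
Qed.

Definition law_of (X : T -> R) (mX : measurable_fun setT X) :
    probability (measurableTypeR R) R :=
  distribution P (HB.pack_for {mfun T >-> measurableTypeR R} X
                   (isMeasurableFun.Build _ _ _ (measurableTypeR R) X mX)).

(** Extends independence from [C] beyond rectangles to arbitrary events of the pair, such as those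
    about a sum of functions of [X] and [Y]. *)
Lemma independent_pair_setI (X Y : T -> R) (C : set T) :
  measurable_fun setT X -> measurable_fun setT Y -> measurable C ->
  (forall A B, measurable A -> measurable B ->
    P (X @^-1` A `&` Y @^-1` B) = (P (X @^-1` A) * P (Y @^-1` B))%E) ->
  (forall A B, measurable A -> measurable B ->
    P (X @^-1` A `&` Y @^-1` B `&` C) =
    (P (X @^-1` A) * P (Y @^-1` B) * P C)%E) ->
  forall E : set (measurableTypeR R * measurableTypeR R), measurable E ->
  P ((fun t => (X t, Y t)) @^-1` E `&` C) =
  (P ((fun t => (X t, Y t)) @^-1` E) * P C)%E.
Proof.
move=> mX mY mC XY XYC E mE.
rewrite (@probability_pair_setI _ _ _ _ _ _ (law_of mX) (law_of mY)) //.
congr (_ * _)%E; rewrite -[X in P X]setIT.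
rewrite (@probability_pair_setI _ _ _ _ _ _ (law_of mX) (law_of mY)) //.
  by rewrite probability_setT mule1.
by move=> A B mA mB; rewrite setIT probability_setT mule1 XY.
Qed.

(** Independence over duplicate-free lists, a form suited to induction along the list. *)
Definition seq_independent (I : eqType) (Z : I -> T -> R) : Prop :=
  forall (s : seq I) (B : I -> set R), uniq s ->
    (forall i, measurable (B i)) ->
    P (\big[setI/setT]_(i <- s) Z i @^-1` B i) =
    (\prod_(i <- s) P (Z i @^-1` B i))%E.

Definition group_sum (I : Type) (K : eqType) (phi : I -> K) (g : I -> R -> R)
    (Z : I -> T -> R) (r : seq I) (k : K) (t : T) : R :=
  \sum_(i <- r | phi i == k) g i (Z i t).

Lemma measurable_group_sum (I : Type) (K : eqType) (phi : I -> K)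
    (g : I -> R -> R) (Z : I -> T -> R) (r : seq I) (k : K) :
  (forall i, measurable_fun setT (Z i)) ->
  (forall i, measurable_fun setT (g i)) ->
  measurable_fun setT (group_sum phi g Z r k).
Proof.
move=> mZ mg; rewrite /group_sum; under eq_fun do rewrite big_mkcond.
apply: measurable_sum => i; case: (phi i == k) => //.
exact: measurableT_comp.
Qed.

(* The variables are merged into the group sums one at a time: r lists those
   already merged and s those still separate. *)
Lemma group_sum_independent (I : eqType) (K : finType) (phi : I -> K)
    (g : I -> R -> R) (Z : I -> T -> R) :
  (forall i, measurable_fun setT (Z i)) ->
  (forall i, measurable_fun setT (g i)) ->
  seq_independent Z ->
  forall (r s : seq I) (A : K -> set R) (B : I -> set R), uniq (r ++ s) ->
  (forall k, measurable (A k)) -> (forall i, measurable (B i)) ->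
  P ((\big[setI/setT]_k group_sum phi g Z r k @^-1` A k) `&`
     \big[setI/setT]_(i <- s) Z i @^-1` B i) =
  ((\prod_k P (group_sum phi g Z r k @^-1` A k)) *
   \prod_(i <- s) P (Z i @^-1` B i))%E.
Proof.
move=> mZ mg indZ; elim => [|j r IH] s A B us mA mB.
  rewrite -indZ //.
  (* With nothing merged, every group sum is the constant 0, so its event is either everything or
     empty. *)
  have W0 k : group_sum phi g Z [::] k @^-1` A k = [set _ | A k 0].
    by apply/seteqP; split => t /=; rewrite /group_sum big_nil.
  rewrite (eq_bigr _ (fun k _ => W0 k)).
  rewrite (eq_bigr _ (fun k _ => congr1 P (W0 k))).
  have [A0|/existsNP[k nA]] := pselect (forall k, A k 0).
    have eT k : [set _ : T | A k 0] = setT.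
      by apply/seteqP; split => t // _; exact: A0.
    rewrite big1 => [|k _]; last exact: eT.
    rewrite [in RHS]big1 ?setTI ?mul1e // => k _.
    by rewrite eT probability_setT.
  have e0 : [set _ : T | A k 0] = set0 by apply/seteqP; split => // t /=.
  rewrite (bigD1 k) //= e0 !set0I measure0.
  by rewrite [in RHS](bigD1 k) //= e0 measure0 !mul0e.
set k0 := phi j.
have mW r' k := measurable_group_sum phi r' k mZ mg.
have Wne k : k != k0 -> group_sum phi g Z (j :: r) k = group_sum phi g Z r k.
  move=> kk0; apply/funext => t.
  by rewrite /group_sum big_cons eq_sym (negbTE kk0).
have We : group_sum phi g Z (j :: r) k0 =
    fun t => g j (Z j t) + group_sum phi g Z r k0 t.
  by apply/funext => t; rewrite /group_sum big_cons eqxx.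
have us' : uniq (r ++ j :: s).
  by rewrite -[j :: s]/([:: j] ++ s) uniq_catCA.
have js : j \notin s.
  by move: us => /=; rewrite mem_cat negb_or => /andP[/andP[]].
(* [C] collects the constraints untouched by merging [Z j] into the group [k0]. *)
pose C := (\big[setI/setT]_(k | k != k0) group_sum phi g Z r k @^-1` A k) `&`
  \big[setI/setT]_(i <- s) Z i @^-1` B i.
have mC : measurable C.
  apply: measurableI; apply: bigsetI_measurable => i _;
    exact: measurable_preimage.
pose c := ((\prod_(k | k != k0) P (group_sum phi g Z r k @^-1` A k)) *
   \prod_(i <- s) P (Z i @^-1` B i))%E.
(* The induction hypothesis with [j] still separate, and with the sets at [k0] and [j] replaced by
   arbitrary [a] and [b]. *)
have Hab a b : measurable a -> measurable b ->
  P (group_sum phi g Z r k0 @^-1` a `&` Z j @^-1` b `&` C) =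
  (P (group_sum phi g Z r k0 @^-1` a) * P (Z j @^-1` b) * c)%E.
  move=> ma mb.
  have mA' k : measurable (if k == k0 then a else A k) by case: ifP.
  have mB' i : measurable (if i == j then b else B i) by case: ifP.
  have := IH (j :: s) _ _ us' mA' mB'.
  rewrite (bigD1 k0) //= big_cons !eqxx.
  rewrite [in X in _ = X -> _](bigD1 k0) //= [in X in _ = X -> _]big_cons !eqxx.
  have eA : \big[setI/setT]_(k | k != k0)
      group_sum phi g Z r k @^-1` (if k == k0 then a else A k) =
      \big[setI/setT]_(k | k != k0) group_sum phi g Z r k @^-1` A k.
    by apply: eq_bigr => k /negbTE ->.
  have eA' : (\prod_(k | k != k0)
      P (group_sum phi g Z r k @^-1` (if k == k0 then a else A k)) =
      \prod_(k | k != k0) P (group_sum phi g Z r k @^-1` A k))%E.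
    by apply: eq_bigr => k /negbTE ->.
  have eB : \big[setI/setT]_(i <- s) Z i @^-1` (if i == j then b else B i) =
      \big[setI/setT]_(i <- s) Z i @^-1` B i.
    by apply: eq_big_seq => i si; case: eqP => // ij; rewrite -ij si in js.
  have eB' : (\prod_(i <- s) P (Z i @^-1` (if i == j then b else B i)) =
      \prod_(i <- s) P (Z i @^-1` B i))%E.
    by apply: eq_big_seq => i si; case: eqP => // ij; rewrite -ij si in js.
  by rewrite eA eA' eB eB' /C /c setIACA muleACA.
have PC : P C = c.
  have := Hab _ _ measurableT measurableT.
  by rewrite !preimage_setT !setTI probability_setT !mul1e.
(* The induction hypothesis with [j] as the only separate variable and all groups but [k0]
   unconstrained. *)
have Hab1 a b : measurable a -> measurable b ->
  P (group_sum phi g Z r k0 @^-1` a `&` Z j @^-1` b) =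
  (P (group_sum phi g Z r k0 @^-1` a) * P (Z j @^-1` b))%E.
  move=> ma mb.
  have mA' k : measurable (if k == k0 then a else setT) by case: ifP.
  have uj : uniq (r ++ [:: j]).
    by move: us'; rewrite -cat_rcons cat_uniq cats1 => /andP[].
  have := IH [:: j] _ (fun=> b) uj mA' (fun=> mb).
  rewrite (bigD1 k0) //= big_seq1 !eqxx.
  rewrite [in X in _ = X -> _](bigD1 k0) //= big_seq1 !eqxx.
  rewrite big1 ?setIT; last by move=> k /negbTE ->; rewrite preimage_setT.
  rewrite [in X in _ = X -> _]big1 ?mule1 // => k /negbTE ->.
  by rewrite preimage_setT probability_setT.
(* The new group sum is [f] of the pair (old group sum, [Z j]), so its event is an event [E] of that
   pair. *)
pose f (p : measurableTypeR R * measurableTypeR R) : measurableTypeR R :=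
  g j p.2 + p.1.
pose E := f @^-1` A k0.
have mE : measurable E.
  have mf : measurable_fun setT f.
    apply: measurable_funD; last exact: measurable_fst.
    by apply: measurableT_comp; [exact: mg|exact: measurable_snd].
  exact: (measurable_preimage mf (mA k0)).
have key := independent_pair_setI (mW r k0) (mZ j) mC Hab1.
rewrite (bigD1 k0) //= [in RHS](bigD1 k0) //= -setIA -muleA.
rewrite We (eq_bigr _ (fun k kk0 => congr1 (fun f => f @^-1` A k) (Wne k kk0))).
rewrite (eq_bigr _
  (fun k kk0 => congr1 (fun f => P (f @^-1` A k)) (Wne k kk0))).
rewrite -/C -/c -PC.
by apply: (key _ E mE) => a b ma mb; rewrite Hab // PC.
Qed.

End independence.

(** * Independent families, normal combinations and sums of squares *)

Section normal_families.
Context d (T : measurableType d) (R : realType) (P : probability T R).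

Lemma mutually_independent_seq (I : finType) (Z : I -> T -> R) :
  mutually_independent P Z -> seq_independent P Z.
Proof.
move=> indZ s B us mB.
rewrite -bigcap_seq [RHS](big_uniq _ us).
rewrite (_ : \bigcap_(i in _) _ =
    [set t | forall i, i \in [set i in s]%SET -> B i (Z i t)]).
  by rewrite indZ //; apply: eq_bigl => i; rewrite inE.
apply/seteqP; split => t /= Bt i; first by rewrite inE => /Bt.
by move=> /= si; apply: Bt; rewrite inE.
Qed.

(** The case where all variables have been merged; groups outside [s] are constrained only by
    [setT]. *)
Lemma group_sum_seq_independent (I K : finType) (phi : I -> K)
    (g : I -> R -> R) (Z : I -> T -> R) :
  (forall i, measurable_fun setT (Z i)) ->
  (forall i, measurable_fun setT (g i)) ->
  seq_independent P Z ->
  seq_independent P (group_sum phi g Z (index_enum I)).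
Proof.
move=> mZ mg indZ s B us mB.
have mB' k : measurable (if k \in s then B k else setT) by case: ifP.
have ue : uniq (index_enum I ++ [::]) by rewrite cats0 index_enum_uniq.
have := group_sum_independent phi mZ mg indZ ue mB' (fun i => measurableT).
rewrite !big_nil setIT mule1 !(big_uniq _ us).
rewrite [in X in _ -> P X = _]big_mkcond [in X in _ -> _ = X]big_mkcond.
rewrite (_ : \big[setI/setT]_k _ = \big[setI/setT]_k
  (if k \in s then group_sum phi g Z (index_enum I) k @^-1` B k else setT)).
  move=> ->; apply: eq_bigr => k _; case: ifP => // _.
  by rewrite preimage_setT probability_setT.
by apply: eq_bigr => k _; case: ifP => // _; rewrite preimage_setT.
Qed.

(** By independence the pair has the product law, so [c * X + Y] has standard deviation [tau] by
    convolution; dividing by [tau] normalizes it. *)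
Lemma has_law_scaled_sum (X Y : T -> R) (s1 s2 c tau : R) :
  0 < s1 -> 0 < s2 -> 0 < tau ->
  tau ^+ 2 = c ^+ 2 * s1 ^+ 2 + s2 ^+ 2 ->
  has_law P X (normal_prob 0 s1) -> has_law P Y (normal_prob 0 s2) ->
  (forall A B, measurable A -> measurable B ->
    P (X @^-1` A `&` Y @^-1` B) = (P (X @^-1` A) * P (Y @^-1` B))%E) ->
  has_law P (fun t => c / tau * X t + tau^-1 * Y t) (normal_prob 0 1).
Proof.
move=> s10 s20 tau0 tauE [mX lX] [mY lY] indXY; split.
  by apply: measurable_funD; exact: measurable_funM.
move=> A mA.
have mA' : measurable (affine tau^-1 0 @^-1` A).
  exact: measurable_preimage (measurable_affine _ _) mA.
have mE : measurable (add_scaled c @^-1` (affine tau^-1 0 @^-1` A)).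
  exact: measurable_preimage (measurable_add_scaled _) mA'.
have rect B C : measurable B -> measurable C ->
    P (X @^-1` B `&` Y @^-1` C `&` setT) =
    (normal_prob 0 s1 B * normal_prob 0 s2 C * P setT)%E.
  by move=> mB mC; rewrite setIT probability_setT mule1 indXY // lX // lY.
have := @probability_pair_setI _ _ _ P _ _ (measurableTypeR R)
  (measurableTypeR R) X Y _ _ setT mX mY measurableT rect _ mE.
rewrite setIT probability_setT mule1 normal_prob_convolution // -tauE.
rewrite sqrtr_sqr gtr0_norm // normal_prob_affine ?invr_gt0 ?gt_eqF //.
rewrite mulr0 addr0 mulVf ?gt_eqF // => XY; rewrite -[RHS]XY.
congr (P _); apply/seteqP; split => t /=; rewrite /affine /add_scaled /= addr0;
  by rewrite mulrDr mulrA [_ / tau]mulrC.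
Qed.

(** The induction follows the recursion of [chi2]: the sum over the tail is independent of the head,
    so their joint law is the product used in the definition. *)
Lemma chi2_sum_sqr (I : eqType) (Z : I -> T -> R) (r : seq I) : uniq r ->
  seq_independent P Z -> (forall i, has_law P (Z i) (normal_prob 0 1)) ->
  forall A : set R, measurable A ->
  P ((fun t => \sum_(i <- r) Z i t ^+ 2) @^-1` A) = chi2 R (size r) A.
Proof.
move=> + indZ lawZ; elim: r => [_ A mA|j r IH /= /andP[jr ur] A mA].
  rewrite /= diracE.
  case: (boolP (0 \in A)) => [|/negP] A0.
    rewrite (_ : _ @^-1` _ = setT) ?probability_setT //.
    by apply/seteqP; split => // t _; rewrite /= big_nil; exact: set_mem.
  rewrite (_ : _ @^-1` _ = set0) ?measure0 //.
  by apply/seteqP; split => // t; rewrite /= big_nil => /mem_set.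
have mZ i : measurable_fun setT (Z i) by have [] := lawZ i.
pose X t := \sum_(i <- r) Z i t ^+ 2.
have mX : measurable_fun setT X.
  by apply: measurable_sum => i; exact: measurable_funX.
have mE : measurable (@add_sqr R @^-1` A).
  exact: measurable_preimage (@measurable_add_sqr R) mA.
have := @probability_pair_setI _ _ _ P _ _ (measurableTypeR R)
  (measurableTypeR R) X (Z j) (chi2 R (size r)) (normal_prob 0 1) setT
  mX (mZ j) measurableT _ _ mE.
rewrite setIT probability_setT mule1 => <-.
  by congr (P _); apply/seteqP; split => t /=;
    rewrite big_cons /add_sqr /= addrC.
move=> a b ma mb; rewrite setIT mule1.
have us : uniq (r ++ [:: j]) by rewrite cats1 rcons_uniq jr.
have msq (i : I) : measurable_fun setT (fun x : R => x ^+ 2).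
  by apply: measurable_funX; exact: measurable_id.
(* A single group, indexed by [tt], gathers the whole tail [r], while [j] stays separate. *)
have := group_sum_independent (fun=> tt) mZ msq indZ us (fun=> ma) (fun=> mb).
rewrite !big_seq1.
have [_ ->] := lawZ j; last by [].
rewrite !(big_pred1 tt) => [|[]|[]] //.
have -> : group_sum (fun=> tt) (fun=> (fun x : R => x ^+ 2)) Z r tt = X by [].
by rewrite (IH ur).
Qed.

End normal_families.

(** * Chi-square mass of intervals *)

Section chi2_positive.
Context (R : realType).

(** On [[u, v]] with [0 <= u] the density is at least its value at [v], which is positive. *)
Lemma normal_prob_itv_gt0 (u v : R) : 0 <= u -> u < v ->
  (0 < normal_prob (0 : R) 1 `[u, v]%classic)%E.
Proof.
move=> u0 uv; apply: (@lt_le_trans _ _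
    (\int[lebesgue_measure]_(x in `[u, v]%classic) (normal_pdf 0 1 v)%:E)%E).
  rewrite integral_cst //= lebesgue_measure_itv /= lte_fin uv -EFinB -EFinM.
  rewrite lte_fin mulr_gt0 ?subr_gt0 // normal_pdfE ?oner_neq0 //.
  by rewrite mulr_gt0 ?expR_gt0 // normal_peak_gt0 ?oner_neq0.
apply: ge0_le_integral => //.
- by move=> x _; rewrite lee_fin normal_pdf_ge0.
- apply/measurable_funTS/measurable_EFinP; exact: measurable_normal_pdf.
- move=> x /=; rewrite in_itv /= => /andP[ux xv]; rewrite lee_fin.
  rewrite !normal_pdfE ?oner_neq0 // ler_wpM2l ?normal_peak_ge0 //.
  rewrite ler_expR !subr0 ler_wpM2r ?invr_ge0 ?mulrn_wge0 ?sqr_ge0 //.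
  by rewrite lerN2 ler_sqr ?nnegrE //; lra.
Qed.

(** If the first [k] squares sum to a value in [[k a, k b]] and the next variable lies in
    [[sqrt a, sqrt b]], the new sum lies in [[(k+1) a, (k+1) b]]. Closed intervals make the base
    case work: [[0, 0]] carries the Dirac mass. *)
Lemma chi2_itv_gt0 (k : nat) (a b : R) : 0 <= a -> a < b ->
  (0 < chi2 R k `[(k%:R * a)%R, (k%:R * b)%R]%classic)%E.
Proof.
move=> a0 ab; elim: k => [|k IH].
  by rewrite /= diracE mem_set ?lte01 //= in_itv /= !mul0r lexx.
have b0 : 0 <= b by lra.
have sab : Num.sqrt a < Num.sqrt b by rewrite ltr_sqrt //; lra.
have mE : measurable (@add_sqr R @^-1` `[k.+1%:R * a, k.+1%:R * b]%classic).
  exact: measurable_preimage (@measurable_add_sqr R) (measurable_itv _).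
apply: (@lt_le_trans _ _ ((chi2 R k \x normal_prob (0 : R) 1)%E
   (`[(k%:R * a)%R, (k%:R * b)%R]%classic `*`
    `[Num.sqrt a, Num.sqrt b]%classic))).
  by rewrite product_measure1E // mule_gt0 // normal_prob_itv_gt0 // sqrtr_ge0.
apply: le_measure; rewrite ?inE //; first exact: measurableX.
move=> [x z] [] /=; rewrite !in_itv /= => /andP[ax xb] /andP[az zb].
have z0 : 0 <= z by apply: le_trans az; exact: sqrtr_ge0.
have az2 : a <= z ^+ 2 by rewrite -(sqr_sqrtr a0) ler_sqr ?nnegrE ?sqrtr_ge0.
have zb2 : z ^+ 2 <= b by rewrite -(sqr_sqrtr b0) ler_sqr ?nnegrE ?sqrtr_ge0.
by rewrite /add_sqr /= -natr1 !mulrDl !mul1r !lerD.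
Qed.

Lemma chi2_cdfB (k : nat) (a b : R) : a <= b ->
  (chi2_cdf k b - chi2_cdf k a)%:E = chi2 R k `]a, b]%classic.
Proof.
move=> ab; rewrite /chi2_cdf EFinB !fineK ?fin_num_measure //.
rewrite -(_ : `]-oo, a]%classic `|` `]a, b]%classic = `]-oo, b]%classic);
  last first.
  by rewrite -itv_bndbnd_setU // bnd_simp.
rewrite measureU //; last first.
  apply/seteqP; split => // x []; rewrite /= !in_itv /= => xa /andP[ax _].
  by have := le_lt_trans xa ax; rewrite ltxx.
by rewrite addeAC subee ?add0e // fin_num_measure.
Qed.

End chi2_positive.

(** * The chi-square statistics of the measurement model *)

Section rayleigh.
Context (R : realType) (d : measure_display) (T : measurableType d)
  (P : probability T R) (N : nat) (sigmaH sigmaV : R)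
  (Ps : 'I_2 -> R) (S : 'I_2 -> 'I_N -> R)
  (H V X : 'I_2 -> 'I_N -> T -> complex R)
  (model : rayleigh_model P sigmaH sigmaV Ps S H V X).

Local Notation noise := (noise_part H V).

(* The variance of the real and imaginary parts of X_{l,i}. *)
Definition observation_var (l : 'I_2) : R := Ps l * sigmaH ^+ 2 + sigmaV ^+ 2.

(** Forgetting [b] puts into one group the two noises, from [H] and from [V], that make up the same
    part of [X l i]. *)
Definition noise_index (k : 'I_2 * 'I_N * bool * bool) : 'I_2 * 'I_N * bool :=
  let: (l, i, b, c) := k in (l, i, c).

Definition noise_weight (k : 'I_2 * 'I_N * bool * bool) (x : R) : R :=
  let: (l, i, b, c) := k in
  let tau := Num.sqrt (observation_var l) in
  (if b then S l i / tau else tau^-1) * x.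

(** The real or imaginary part of [X l i] divided by its standard deviation. Writing it as a group
    sum of the noises makes independence an instance of [group_sum_seq_independent]. *)
Definition std_observation : 'I_2 * 'I_N * bool -> T -> R :=
  group_sum noise_index noise_weight noise (index_enum _).

Definition chi2_stat (l : 'I_2) (t : T) : R :=
  (2 * N)%:R * mean_sqr X l t / observation_var l.

Lemma observation_var_gt0 l : 0 < observation_var l.
Proof.
have [_ V0 P0 P1 _ _ _ _ _ _ _] := model.
rewrite ltr_wpDl ?exprn_gt0 // mulr_ge0 ?sqr_ge0 //.
case: l => [[|[|//]] il].
  by rewrite (_ : Ordinal il = ord0) ?(le_trans P0 (ltW P1)) //; exact: val_inj.
by rewrite (_ : Ordinal il = ord_max) //; exact: val_inj.
Qed.

Lemma measurable_noise k : measurable_fun setT (noise k).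
Proof.
have [_ _ _ _ _ HR HI VR VI _ _] := model.
case: k => [[[l i] []] []]; [exact: (HR l i).1|exact: (HI l i).1|
  exact: (VR l i).1|exact: (VI l i).1].
Qed.

Lemma noise_law l i b c :
  has_law P (noise (l, i, b, c)) (normal_prob 0 (if b then sigmaH else sigmaV)).
Proof.
have [_ _ _ _ _ HR HI VR VI _ _] := model.
by case: b c => [] []; [exact: HR|exact: HI|exact: VR|exact: VI].
Qed.

Lemma measurable_noise_weight k : measurable_fun setT (noise_weight k).
Proof. by case: k => [[[l i] b] c]; exact: measurable_funM. Qed.

Lemma std_observationE l i c t :
  let tau := Num.sqrt (observation_var l) in
  std_observation (l, i, c) t =
  S l i / tau * noise (l, i, true, c) t + tau^-1 * noise (l, i, false, c) t.
Proof.
rewrite /std_observation /group_sum (bigD1 (l, i, true, c)) //=.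
have ne : (l, i, false, c) != (l, i, true, c) by rewrite !xpair_eqE andbF.
rewrite (bigD1 (l, i, false, c)) ?eqxx ?ne //= big1 ?addr0 //.
move=> [[[l' i'] b] c'] /= /andP[/andP[/eqP[-> -> ->]]].
by case: b; rewrite ?eqxx.
Qed.

(** Since the symbol is real, multiplying by it acts separately on real and imaginary parts. *)
Lemma std_observation_proj l i c t :
  std_observation (l, i, c) t =
  (if c then @complex.Re R else @complex.Im R) (X l i t) /
  Num.sqrt (observation_var l).
Proof.
rewrite std_observationE (rm_observation model) /noise_part.
case: (H l i t) (V l i t) => [a b] [a' b'].
by case: c => /=; rewrite mulr0 ?subr0 ?add0r; ring.
Qed.

Lemma std_observation_law k : has_law P (std_observation k) (normal_prob 0 1).
Proof.
case: k => [[l i] c]; have v0 := observation_var_gt0 l.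
rewrite (funext (std_observationE l i c)).
apply: (@has_law_scaled_sum _ _ _ P _ _ sigmaH sigmaV) => //.
- exact: rm_sigmaH_gt0 model.
- exact: rm_sigmaV_gt0 model.
- by rewrite sqrtr_gt0.
- rewrite sqr_sqrtr ?ltW // /observation_var -(rm_symbol model l i).
  by rewrite real_normK ?num_real.
- exact: noise_law.
- exact: noise_law.
move=> A B mA mB.
have ind := mutually_independent_seq (rm_independent model).
have := ind [:: (l, i, true, c); (l, i, false, c)]
  (fun k => let: (_, _, b, _) := k in if b then A else B).
rewrite !big_cons !big_nil setIT mule1; apply.
  by rewrite /= inE !xpair_eqE andbF.
by case=> [[[? ?] []] ?].
Qed.

Lemma measurable_std_observation k : measurable_fun setT (std_observation k).
Proof. by have [] := std_observation_law k. Qed.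

Lemma std_observation_independent : seq_independent P std_observation.
Proof.
apply: group_sum_seq_independent; first exact: measurable_noise.
  exact: measurable_noise_weight.
exact: mutually_independent_seq (rm_independent model).
Qed.

(** A second grouping, now by power level: it yields both the law of each statistic and the
    independence of the two. *)
Lemma chi2_statE :
  chi2_stat = group_sum (fun k => k.1.1) (fun=> (fun x : R => x ^+ 2))
    std_observation (index_enum _).
Proof.
apply/funext => l; apply/funext => t; rewrite /group_sum /chi2_stat /mean_sqr.
have v0 := observation_var_gt0 l.
(* The factor [2 * N] cancels only for positive [N]; for [N = 0] both sides are 0. *)
case: (posnP N) => [N0|N0].
  rewrite [RHS]big1 => [|[[l' i] c] _].
    by rewrite (_ : (2 * N)%N = 0%N) ?N0 // mul0r mul0r.
  by have := ltn_ord i; rewrite [in X in (_ < X)%N -> _]N0.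
rewrite mulrA divff ?mul1r ?pnatr_eq0 ?muln_eq0 ?gtn_eqF //.
rewrite mulr_suml.
(* The trivial conjunct gives the predicate the shape [pair_big_dep] expects; the sum is unfolded
   first over [c], then over [i]. *)
rewrite (eq_bigl (fun k => (k.1.1 == l) && true)) => [|k];
  last by rewrite andbT.
rewrite -(pair_big_dep (fun li => li.1 == l) (fun _ _ => true)
  (fun li c => std_observation (li, c) t ^+ 2)) /=.
rewrite (eq_bigl (fun k => (k.1 == l) && true)) => [|k];
  last by rewrite andbT.
rewrite -(pair_big_dep (fun l' => l' == l) (fun _ _ => true)
  (fun l' i => \sum_c std_observation (l', i, c) t ^+ 2)) /=.
rewrite big_pred1_eq; apply: eq_bigr => i _.
rewrite big_bool !std_observation_proj /= !expr_div_n sqr_sqrtr ?ltW //.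
case: (X l i t) => a b /=; rewrite sqr_sqrtr ?addr_ge0 ?sqr_ge0 //.
by rewrite mulrDl.
Qed.

Lemma measurable_chi2_stat l : measurable_fun setT (chi2_stat l).
Proof.
rewrite chi2_statE; apply: measurable_group_sum => k.
  exact: measurable_std_observation.
by apply: measurable_funX; exact: measurable_id.
Qed.

Lemma chi2_stat_law l (A : set R) : measurable A ->
  P (chi2_stat l @^-1` A) = chi2 R (2 * N) A.
Proof.
move=> mA.
(* The [N] observations at level [l] have two parts each, which gives the [2 * N] degrees of
   freedom. *)
pose r := [seq k <- index_enum ('I_2 * 'I_N * bool)%type | k.1.1 == l].
have sr : size r = (2 * N)%N.
  rewrite -sum1_size big_filter sum1dep_card.
  rewrite (_ : finset _ = finset.setX
    (finset.setX (finset.set1 l) (finset.setTfor _)) (finset.setTfor _)).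
    by rewrite !cardsX cards1 !cardsT card_ord card_bool mul1n mulnC.
  by apply/finset.setP => -[[l' i] c]; rewrite !inE /= !andbT.
rewrite -sr -(@chi2_sum_sqr _ _ _ P _ std_observation) //.
- by congr (P _); apply/seteqP; split => t /=;
    rewrite chi2_statE /group_sum big_filter.
- by rewrite filter_uniq // index_enum_uniq.
- exact: std_observation_independent.
- exact: std_observation_law.
Qed.

Lemma chi2_stat_independent (A B : set R) : measurable A -> measurable B ->
  P (chi2_stat ord0 @^-1` A `&` chi2_stat ord_max @^-1` B) =
  (chi2 R (2 * N) A * chi2 R (2 * N) B)%E.
Proof.
move=> mA mB.
have msq (k : 'I_2 * 'I_N * bool) : measurable_fun setT (fun x : R => x ^+ 2).
  by apply: measurable_funX; exact: measurable_id.
have := group_sum_seq_independent (fun k : 'I_2 * 'I_N * bool => k.1.1)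
  measurable_std_observation msq std_observation_independent.
rewrite -chi2_statE.
move=> /(_ [:: ord0; ord_max] (fun l => if l == ord0 then A else B)).
rewrite !big_cons !big_nil /= setIT mule1 !chi2_stat_law //; apply => //.
by move=> l; case: ifP.
Qed.

End rayleigh.

(** * The event in terms of the two statistics, and its probability *)

(** With [r = (p * h + v) / v], the middle term is [(r - 1) / p] and [m0 / m1] is [r * (q0 / q1)].
    The factor [r] cancels, leaving two bounds on [q0 / q1] free of the unknown variances. *)
Lemma ratio_boundsE (R : realType) (e p h v n q0 q1 m0 m1 : R) :
  0 < e < 1 -> 0 < p -> 0 <= h -> 0 < v -> 0 < n -> 0 <= q1 ->
  q0 = n * m0 / (p * h + v) -> q1 = n * m1 / v ->
  (p^-1 * ((1 - e) * m0 / ((1 + e) * m1) - 1) < h / v <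
   p^-1 * ((1 + e) * m0 / ((1 - e) * m1) - 1)) =
  [&& 0 < q1, (1 - e) * q0 < (1 + e) * q1 & (1 - e) * q1 < (1 + e) * q0].
Proof.
move=> /andP[e0 e1] p0 h0 v0 n0 q10 q0E q1E.
have w0 : 0 < p * h + v by rewrite ltr_wpDl // mulr_ge0 // ltW.
have m0E : m0 = q0 * (p * h + v) / n by rewrite q0E; field; rewrite !gt_eqF.
have m1E : m1 = q1 * v / n by rewrite q1E; field; rewrite !gt_eqF.
move: q10; rewrite le_eqVlt => /predU1P[q1_0|q10].
  (* Division by zero yields 0, so for [q1 = 0] both bounds equal [- p^-1] and the strict double
     inequality fails. *)
  rewrite -q1_0 ltxx /= m1E -q1_0 !mul0r !mulr0 invr0 !mulr0.
  by apply/negP => /andP[/lt_trans h1 /h1]; rewrite ltxx.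
rewrite q10 /=.
have -> : h / v = p^-1 * ((p * h + v) / v - 1) by field; rewrite !gt_eqF.
rewrite !ltr_pM2l ?invr_gt0 // !ltrD2r m0E m1E.
have -> : (1 - e) * (q0 * (p * h + v) / n) / ((1 + e) * (q1 * v / n)) =
  (1 - e) * q0 / ((1 + e) * q1) * ((p * h + v) / v).
  by field; rewrite !gt_eqF //; lra.
have -> : (1 + e) * (q0 * (p * h + v) / n) / ((1 - e) * (q1 * v / n)) =
  (1 + e) * q0 / ((1 - e) * q1) * ((p * h + v) / v).
  by field; rewrite !gt_eqF //; lra.
have c0 : 0 < (p * h + v) / v by rewrite divr_gt0.
rewrite gtr_pMl // ltr_pMl // ltr_pdivrMr ?mul1r ?ltr_pdivlMr ?mul1r //.
  by rewrite mulr_gt0 //; lra.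
by rewrite mulr_gt0 //; lra.
Qed.

Theorem corollary2 (R : realType) (d : measure_display) (T : measurableType d)
    (P : probability T R) (eps delta : R) (N : nat) (sigmaH sigmaV : R)
    (Ps : 'I_2 -> R) (S : 'I_2 -> 'I_N -> R)
    (H V X : 'I_2 -> 'I_N -> T -> complex R)
    (eps_in : 0 < eps < 1) (delta_in : 0 < delta < 1)
    (Ps1_gt0 : 0 < Ps ord0) (Ps2_eq0 : Ps ord_max = 0)
    (N_gt0 : (0 < N)%N) (N_cond : chi2_condition eps delta N)
    (N_min : forall M : nat, (0 < M)%N -> chi2_condition eps delta M ->
       (N <= M)%N)
    (model : rayleigh_model P sigmaH sigmaV Ps S H V X) :
  ((1 - delta)%:E <
   P [set t | (Ps ord0)^-1 *
                ((1 - eps) * mean_sqr X ord0 t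
                   / ((1 + eps) * mean_sqr X ord_max t) - 1)
              < sigmaH ^+ 2 / sigmaV ^+ 2 <
              (Ps ord0)^-1 *
                ((1 + eps) * mean_sqr X ord0 t
                   / ((1 - eps) * mean_sqr X ord_max t) - 1)]%R)%E.
Proof.
have /andP[e0 e1] := eps_in; have /andP[d0 d1] := delta_in.
pose n : R := (2 * N)%:R; have n0 : 0 < n by rewrite ltr0n muln_gt0.
pose Q := chi2_stat sigmaH sigmaV Ps X.
have mQ l : measurable_fun setT (Q l) := measurable_chi2_stat model l.
have Q0 l t : 0 <= Q l t.
  rewrite /Q /chi2_stat divr_ge0 ?(ltW (observation_var_gt0 model l)) //.
  rewrite mulr_ge0 // mulr_ge0 ?invr_ge0 // sumr_ge0 // => i _.
  exact: sqr_ge0.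
set E := [set t | _].
have EE : E = [set t | [&& 0 < Q ord_max t,
    (1 - eps) * Q ord0 t < (1 + eps) * Q ord_max t &
    (1 - eps) * Q ord_max t < (1 + eps) * Q ord0 t]].
  apply/funext => t; congr is_true; apply: (ratio_boundsE (n := n)) => //.
  - exact: sqr_ge0.
  - by rewrite exprn_gt0 // (rm_sigmaV_gt0 model).
  - by rewrite /Q /chi2_stat /observation_var Ps2_eq0 mul0r add0r.
have mE : measurable E.
  have mlt (f g : T -> R) : measurable_fun setT f -> measurable_fun setT g ->
      measurable [set t | f t < g t].
    move=> mf mg; have := measurable_fun_ltr mf mg.
    by move=> /(_ measurableT [set true] I); rewrite setTI.
  rewrite EE (_ : [set t | _] = [set t | 0 < Q ord_max t] `&`
    ([set t | (1 - eps) * Q ord0 t < (1 + eps) * Q ord_max t] `&`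
     [set t | (1 - eps) * Q ord_max t < (1 + eps) * Q ord0 t])).
    by apply: measurableI; [|apply: measurableI]; apply: mlt => //;
      exact: measurable_funM.
  by apply/seteqP; split => t /= => [/and3P[]|[? []]] // *; apply/and3P.
(* Two values in [[n * u, n * v]] satisfy the ratio bounds as soon as
   [(1 - eps) * v < (1 + eps) * u]. This [v] makes the left side [(1 + eps) ^+ 2], so any [u] above
   [1 + eps] works; the midpoint also stays below [v]. *)
pose v := (1 + eps) ^+ 2 / (1 - eps).
pose u := ((1 + eps) + v) / 2.
have vE : (1 - eps) * v = (1 + eps) ^+ 2.
  by rewrite /v mulrC divfK // gt_eqF //; lra.
have nvE : (1 - eps) * (n * v) = n * (1 + eps) ^+ 2 by rewrite -vE mulrCA.
have u1 : 1 + eps < u by rewrite /u; nra.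
have nu1 : n * (1 + eps) < n * u by rewrite ltr_pM2l.
have uv : u < v by rewrite /u; nra.
pose A := `]((1 - eps) * n), ((1 + eps) * n)]%classic : set R.
pose B := `[(n * u), (n * v)]%classic : set R.
pose G (C : set R) := Q ord0 @^-1` C `&` Q ord_max @^-1` C.
have PG C : measurable C -> P (G C) = (chi2 R (2 * N) C * chi2 R (2 * N) C)%E.
  by move=> mC; exact: (chi2_stat_independent model).
have mG C : measurable C -> measurable (G C).
  by move=> mC; apply: measurableI; exact: measurable_preimage.
have mA : measurable A by exact: measurable_itv.
have mB : measurable B by exact: measurable_itv.
have inA q : A q -> (1 - eps) * n < q <= (1 + eps) * n by rewrite /A /= in_itv.
have inB q : B q -> n * u <= q <= n * v by rewrite /B /= in_itv.
have GE : G A `|` G B `<=` E.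
  rewrite EE => t [] [].
    (* Either product [(1 - eps) * q] is at most [(1 - eps) * (1 + eps) * n], and the open left end
       of [A] puts the other product [(1 + eps) * q'] strictly above this. *)
    move=> /inA/andP[h1 h2] /inA/andP[h3 h4].
    by apply/and3P; split; nra.
  move=> /inB/andP[h1 h2] /inB/andP[h3 h4].
  apply/and3P; split; first by nra.
    apply: (@le_lt_trans _ _ (n * (1 + eps) ^+ 2)).
      by rewrite -nvE ler_pM2l //; lra.
    by rewrite expr2 mulrCA ltr_pM2l; lra.
  apply: (@le_lt_trans _ _ (n * (1 + eps) ^+ 2)).
    by rewrite -nvE ler_pM2l //; lra.
  by rewrite expr2 mulrCA ltr_pM2l; lra.
apply: (@lt_le_trans _ _ (P (G A `|` G B))); last first.
  by apply: le_measure; rewrite ?inE //; apply: measurableU; exact: mG.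
have -> : P (G A `|` G B) = (P (G A) + P (G B))%E.
  apply: measureU; [exact: mG|exact: mG|].
  apply/seteqP; split => // t [] [/inA/andP[_ h1] _] [/inB/andP[h2 _] _].
  by have := lt_le_trans nu1 (le_trans h2 h1); rewrite mulrC ltxx.
rewrite !PG //.
have Bgt0 : (0 < chi2 R (2 * N) B)%E by apply: chi2_itv_gt0 => //; lra.
(* The difference of cdf values in [N_cond] is exactly the mass of the half-open interval [A]. *)
have Age : ((Num.sqrt (1 - delta))%:E <= chi2 R (2 * N) A)%E.
  rewrite -chi2_cdfB ?lee_fin //; by nra.
rewrite -[ltLHS]adde0; apply: lee_ltD => //.
- rewrite -[X in X%:E](@sqr_sqrtr _ (1 - delta)); last by lra.
  by rewrite expr2 EFinM lee_pmul // lee_fin sqrtr_ge0.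
- by rewrite mule_gt0.
Qed.
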